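(* For every positive integer $x$ and every positive integer $n$, \[ H^{(n)}(x)=\prod_{k=1}^{x}k^{\,k\,P_{n-1}((x-k)+1)}. \]
   Context: For integers $r\ge 0$ and $m\ge 1$, the $r$-simplex (figurate) number is $P_r(m)=\binom{m+r-1}{r}$ (so $P_0(m)=1$). The generalized ($n$th-degree) hyperfactorial is defined for positive integers $x$ by $H^{(1)}(x)=\prod_{k=1}^{x}k^{k}$ (the usual hyperfactorial) and, for $n\ge 2$, $H^{(n)}(x)=\prod_{k=1}^{x}H^{(n-1)}(k)$. *)

(* Defs.v *)
From mathcomp Require Import all_boot.

Set Implicit Arguments.
Unset Strict Implicit.
Unset Printing Implicit Defensive.

(* P_r(m), meaningful for m >= 1, where the subtraction is not truncated. *)
Definition simplex (r m : nat) : nat := 'C(m + r - 1, r).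

Definition hyperfactorial (x : nat) : nat := \prod_(1 <= k < x.+1) k ^ k.

(* H^(n)(x); the degree starts at n = 1, and the value at n = 0 is a dummy. *)
Fixpoint gen_hyperfactorial (n x : nat) : nat :=
  match n with
  | 0 => 0
  | 1 => hyperfactorial x
  | n'.+1 => \prod_(1 <= k < x.+1) gen_hyperfactorial n' k
  end.

(* Main.v *)
(** Passing from [x] to [x + 1] multiplies the degree [n + 1] hyperfactorial by
    the degree [n] one at [x + 1]; on the exponent of each [k] this is Pascal's
    rule for simplex numbers, so a double induction on [n] and [x] concludes. *)
Require Import Defs.
From mathcomp Require Import all_boot.

Lemma simplex_one (r : nat) : simplex r 1 = 1.
Proof. by rewrite /simplex add1n subn1 /= binn. Qed.

(** Pascal's rule for ['C(m + r + 2, r + 1)]; it is used with [m = x - k]. *)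
Lemma simplex_pascal (r m : nat) :
  simplex r.+1 m.+2 = simplex r.+1 m.+1 + simplex r m.+2.
Proof. by rewrite /simplex !addSn !addnS !subn1 /= binS. Qed.

Lemma gen_hyperfactorialSS (n x : nat) :
  gen_hyperfactorial n.+2 x = \prod_(1 <= k < x.+1) gen_hyperfactorial n.+1 k.
Proof. by []. Qed.

Lemma gen_hyperfactorialS_prod (n x : nat) :
  gen_hyperfactorial n.+1 x =
  \prod_(1 <= k < x.+1) k ^ (k * simplex n ((x - k) + 1)).
Proof.
elim: n x => [|n IHn] x.
  by apply: eq_bigr => k _; rewrite /simplex bin0 muln1.
rewrite gen_hyperfactorialSS; elim: x => [|x IHx]; first by rewrite !big_nil.
rewrite big_nat_recr // IHx IHn /=.
(* With the factor at [k = x.+1] set aside, both products run over [1 <= k <= x] and merge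
   termwise. *)
rewrite [X in _ * X]big_nat_recr //= mulnA -big_split /=.
(* The factors at [k = x.+1] agree, since simplex numbers of every order are 1 at 1. *)
rewrite [RHS]big_nat_recr //= subnn !simplex_one; congr (_ * _).
apply: eq_big_nat => k /andP[_ le_kx].
(* Here [k <= x] ensures that [x.+1 - k] is [(x - k).+1], without truncation. *)
by rewrite subSn // !addn1 simplex_pascal mulnDr expnD.
Qed.

Theorem theorem4p2 (x n : nat) (hx : 0 < x) (hn : 0 < n) :
  gen_hyperfactorial n x =
  \prod_(1 <= k < x.+1) k ^ (k * simplex (n - 1) ((x - k) + 1)).
Proof. by case: n hn => // n _; rewrite subn1 gen_hyperfactorialS_prod. Qed.
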